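(* Let $V$ be a finite dimensional (real or complex) vector space endowed with a linear Dirac structure $L=L(E,\varepsilon)$. Let $W=\ker\varepsilon\subseteq E\subseteq V$ and denote by $\varphi:V\to V/W$ the projection. Then $L=\varphi^*(\varphi_*(L))$ and $\varphi_*(L)$ is a linear Poisson structure on $V/W$.
   Context: For a finite dimensional vector space $V$ (real or complex), $V\oplus V^*$ carries the form $\langle u+\alpha,v+\beta\rangle=\tfrac12(\alpha(v)+\beta(u))$. A linear Dirac structure on $V$ is a maximal isotropic subspace of $V\oplus V^*$. For a subspace $E\subseteq V$ and $\varepsilon\in\Lambda^2E^*$ put $L(E,\varepsilon)=\{u+\alpha\mid u\in E,\ \alpha|_E=\varepsilon(u,\cdot)\}$; every linear Dirac structure is of this form for a unique pair $(E,\varepsilon)$. Here $\ker\varepsilon=\{u\in E\mid\varepsilon(u,\cdot)=0 \text{ on } E\}$. A linear Dirac structure $L$ on $V$ is a linear Poisson structure if the projection of $L\subseteq V\oplus V^*$ to $V^*$ is all of $V^*$ (equivalently, $L$ is the graph of a map $V^*\to V$ given by a bivector in $\Lambda^2V$). For a linear map $f:V\to V'$ and linear Dirac structures $L$ on $V$, $L'$ on $V'$: $f_*(L)=\{f(X)+\xi\mid X+f^*(\xi)\in L\}$ and $f^*(L')=\{X+f^*(\xi)\mid f(X)+\xi\in L'\}$. *)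

(* Defs.v *)
From HB Require Import structures.
From mathcomp Require Import all_boot all_order all_algebra.
From mathcomp Require Import generic_quotient ring_quotient.

Set Implicit Arguments.
Unset Strict Implicit.
Unset Printing Implicit Defensive.

Import GRing.Theory.
Local Open Scope ring_scope.
Local Open Scope quotient_scope.

(* MathComp only provides V / W as an abelian group ([Quotient.quot]); the
   vector space structure is added here. *)
Section QuotientSpace.
Import VectorInternalTheory.
Variables (K : fieldType) (V : vectType K) (W : {vspace V}).

Definition quotv : Type := Quotient.quot W.
HB.instance Definition _ := GRing.Zmodule.on quotv.

Definition projv_quot (v : V) : quotv := \pi_(Quotient.quot W) v.

Lemma projv_quot_eq u v : (projv_quot u == projv_quot v) = (u - v \in W).
Proof. by rewrite (Quotient.idealrBE W). Qed.

Lemma projv_quotD : {morph projv_quot : u v / u + v}.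
Proof. by move=> u v; exact: (raddfD \pi_(Quotient.quot W)). Qed.

Lemma projv_quot_repr (x : quotv) : projv_quot (repr (x : Quotient.quot W)) = x.
Proof. exact: reprK. Qed.

Definition scale_quot (a : K) (x : quotv) : quotv :=
  projv_quot (a *: repr (x : Quotient.quot W)).

Lemma projv_quotZ a v : projv_quot (a *: v) = scale_quot a (projv_quot v).
Proof.
apply/eqP; rewrite projv_quot_eq -scalerBr memvZ // -projv_quot_eq.
by rewrite projv_quot_repr.
Qed.

Lemma scale_quotA a b x : scale_quot a (scale_quot b x) = scale_quot (a * b) x.
Proof. by rewrite -[x]projv_quot_repr -!projv_quotZ scalerA. Qed.

Lemma scale_quot1 : left_id 1 scale_quot.
Proof. by move=> x; rewrite -[x]projv_quot_repr -projv_quotZ scale1r. Qed.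

Lemma scale_quotDr : right_distributive scale_quot +%R.
Proof.
move=> a x y; rewrite -[x]projv_quot_repr -[y]projv_quot_repr.
by rewrite -projv_quotD -!projv_quotZ scalerDr projv_quotD.
Qed.

Lemma scale_quotDl x : {morph scale_quot^~ x : a b / a + b}.
Proof.
move=> a b; rewrite -[x]projv_quot_repr -!projv_quotZ.
by rewrite scalerDl projv_quotD.
Qed.

HB.instance Definition _ := GRing.Zmodule_isLmodule.Build K quotv
  scale_quotA scale_quot1 scale_quotDr scale_quotDl.

Lemma projv_quot_is_linear : linear projv_quot.
Proof. by move=> a u v; rewrite projv_quotD projv_quotZ. Qed.
HB.instance Definition _ :=
  GRing.isLinear.Build K V quotv *:%R projv_quot projv_quot_is_linear.

(* A complement of W serves only to witness finite dimensionality. *)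
Fact quotv_vect_iso : Vector.axiom (dim (subvs_of (W^C)%VS)) quotv.
Proof.
pose h (x : quotv) : subvs_of (W^C)%VS :=
  vsproj (W^C)%VS (daddv_pi (W^C)%VS W (repr (x : Quotient.quot W))).
pose g (w : subvs_of (W^C)%VS) : quotv := projv_quot (vsval w).
have capW : (W^C :&: W = 0)%VS by rewrite capvC capv_compl.
have g_lin : linear g by move=> a u v; rewrite /g !linearD !linearZ.
have hK : cancel h g.
  move=> x; rewrite -[RHS]projv_quot_repr; apply/eqP.
  rewrite projv_quot_eq vsprojK ?memv_pi //.
  set v := repr _; have vWW : (v \in W^C + W)%VS.
    by rewrite addvC addv_complf memvf.
  rewrite -[X in _ - X](daddv_pi_add capW vWW) opprD addrA subrr sub0r.
  by rewrite memvN memv_pi.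
have gI : injective g.
  move=> u v /eqP; rewrite projv_quot_eq -linearB => uvW.
  apply/eqP; rewrite -subr_eq0; apply/eqP/val_inj/eqP.
  by rewrite -memv0 -capW memv_cap subvsP uvW.
have gK : cancel g h by move=> w; apply: gI; rewrite hK.
pose gM := GRing.isLinear.Build _ _ _ _ g g_lin.
pose gL : {linear subvs_of (W^C)%VS -> quotv} := HB.pack g gM.
have h_lin : linear h := @can2_linear _ _ _ gL h gK hK.
pose hM := GRing.isLinear.Build _ _ _ _ h h_lin.
pose hL : {linear quotv -> subvs_of (W^C)%VS} := HB.pack h hM.
exists (v2r \o hL); first by move=> a x y; rewrite [LHS]linearP.
by exists (g \o r2v) => [x|r] /=; rewrite ?v2rK ?hK // gK r2vK.
Qed.
HB.instance Definition _ := Lmodule_hasFinDim.Build K quotv quotv_vect_iso.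

Definition quotv_map : 'Hom(V, quotv) := linfun projv_quot.

Lemma lker_quotv_map : lker quotv_map = W.
Proof.
apply/vspaceP=> v; rewrite memv_ker lfunE /=.
by rewrite -[0](linear0 projv_quot) projv_quot_eq subr0.
Qed.

Lemma limg_quotv_map : limg quotv_map = fullv.
Proof.
apply/vspaceP=> x; rewrite memvf; apply/memv_imgP.
by exists (repr (x : Quotient.quot W)); rewrite ?memvf // lfunE /= projv_quot_repr.
Qed.

End QuotientSpace.

Section Dirac.
Variables (K : fieldType) (V : vectType K).
Local Notation Vd := (V * 'Hom(V, K^o))%type.

Definition dirac_pairing (x y : Vd) : K :=
  2%:R^-1 * ((x.2 y.1 : K) + (y.2 x.1 : K)).

Definition isotropic (L : {vspace Vd}) : Prop :=
  forall x y, x \in L -> y \in L -> dirac_pairing x y = 0.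

Definition linear_dirac (L : {vspace Vd}) : Prop :=
  isotropic L /\
  forall M : {vspace Vd}, isotropic M -> (L <= M)%VS -> M = L.

Definition linear_poisson (L : {vspace Vd}) : Prop :=
  linear_dirac L /\ (linfun snd @: L)%VS = fullv.

Variable E : {vspace V}.
Local Notation Ed := 'Hom(subvs_of E, K^o).

(* A bilinear form on E is a linear map E -> E^*; the elements of the second
   exterior power of E^* are the alternating ones. *)
Definition alternating (eps : 'Hom(subvs_of E, Ed)) : Prop :=
  forall u, eps u u = 0.

Variable eps : 'Hom(subvs_of E, Ed).

Definition form_ker : {vspace V} := (linfun vsval @: lker eps)%VS.

(* L(E, eps) is the image in V + V^* of the set of pairs (u, alpha), with u in E
   and alpha in V^*, on which [dirac_defect] vanishes. *)
Definition dirac_defect (p : subvs_of E * 'Hom(V, K^o)) : Ed :=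
  (p.2 \o linfun vsval)%VF - eps p.1.

Fact dirac_defect_is_linear : linear dirac_defect.
Proof.
move=> a p q; apply/lfunP=> v; rewrite /dirac_defect /=.
rewrite linearP !(comp_lfunE, scale_lfunE, opp_lfunE, add_lfunE) scalerBr.
by rewrite opprD addrACA.
Qed.
HB.instance Definition _ :=
  GRing.isLinear.Build K (subvs_of E * 'Hom(V, K^o))%type Ed *:%R
    dirac_defect dirac_defect_is_linear.

Definition dirac_incl (p : subvs_of E * 'Hom(V, K^o)) : Vd := (vsval p.1, p.2).

Fact dirac_incl_is_linear : linear dirac_incl.
Proof. by move=> a p q; congr (_, _); exact: (linearP vsval). Qed.
HB.instance Definition _ :=
  GRing.isLinear.Build K (subvs_of E * 'Hom(V, K^o))%type Vd *:%R
    dirac_incl dirac_incl_is_linear.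

Definition dirac_of : {vspace Vd} :=
  (linfun dirac_incl @: lker (linfun dirac_defect))%VS.

Lemma form_kerP (w : V) :
  reflect (exists2 u : subvs_of E, w = vsval u & forall v, eps u v = 0)
          (w \in form_ker).
Proof.
apply: (iffP memv_imgP) => [[u]|[u -> eu]].
  rewrite memv_ker lfunE /= => /eqP eu ->.
  by exists u => // v; rewrite eu zero_lfunE.
exists u; last by rewrite lfunE.
by rewrite memv_ker; apply/eqP/lfunP=> v; rewrite eu zero_lfunE.
Qed.

Lemma dirac_ofP (x : Vd) :
  reflect (exists2 u : subvs_of E, x.1 = vsval u &
             forall v : subvs_of E, x.2 (vsval v) = eps u v)
          (x \in dirac_of).
Proof.
apply: (iffP memv_imgP) => [[p]|[u xu xe]].
  rewrite memv_ker !lfunE /= subr_eq0 => /eqP pe ->.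
  by exists p.1 => // v; rewrite -pe !lfunE /= lfunE.
exists (u, x.2); last by rewrite lfunE /= /dirac_incl /= -xu; case: (x).
rewrite memv_ker lfunE /= subr_eq0; apply/eqP/lfunP=> v.
by rewrite -xe !lfunE /= lfunE.
Qed.

End Dirac.

Section Functoriality.
Variables (K : fieldType) (V V' : vectType K) (f : 'Hom(V, V')).
Local Notation Vd := (V * 'Hom(V, K^o))%type.
Local Notation Vd' := (V' * 'Hom(V', K^o))%type.
Local Notation mixed := (V * 'Hom(V', K^o))%type.

(* The two maps V + V'^* -> V + V^* and V + V'^* -> V' + V'^* sending X + xi to
   X + f^* xi and to f X + xi. *)
Definition mixed_left (p : mixed) : Vd := (p.1, (p.2 \o f)%VF).
Definition mixed_right (p : mixed) : Vd' := (f p.1, p.2).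

Fact mixed_left_is_linear : linear mixed_left.
Proof.
move=> a p q; rewrite /mixed_left /=; congr (_, _).
by apply/lfunP=> v; rewrite !lfun_simp.
Qed.
HB.instance Definition _ :=
  GRing.isLinear.Build K mixed Vd *:%R mixed_left mixed_left_is_linear.

Fact mixed_right_is_linear : linear mixed_right.
Proof. by move=> a p q; congr (_, _); exact: (linearP f). Qed.
HB.instance Definition _ :=
  GRing.isLinear.Build K mixed Vd' *:%R mixed_right mixed_right_is_linear.

Definition dirac_push (L : {vspace Vd}) : {vspace Vd'} :=
  (linfun mixed_right @: (linfun mixed_left @^-1: L))%VS.

Definition dirac_pull (L' : {vspace Vd'}) : {vspace Vd} :=
  (linfun mixed_left @: (linfun mixed_right @^-1: L'))%VS.

Lemma dirac_pushP (L : {vspace Vd}) (y : Vd') :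
  reflect (exists2 X, y.1 = f X & (X, (y.2 \o f)%VF) \in L)
          (y \in dirac_push L).
Proof.
apply: (iffP memv_imgP) => [[p]|[X yX XL]].
  by rewrite -memv_preim !lfunE /= => pL ->; exists p.1.
exists (X, y.2); first by rewrite -memv_preim lfunE.
by rewrite lfunE /= /mixed_right /= -yX; case: (y).
Qed.

Lemma dirac_pullP (L' : {vspace Vd'}) (x : Vd) :
  reflect (exists2 xi : 'Hom(V', K^o), x.2 = (xi \o f)%VF & (f x.1, xi) \in L')
          (x \in dirac_pull L').
Proof.
apply: (iffP memv_imgP) => [[p]|[xi xxi xiL]].
  by rewrite -memv_preim !lfunE /= => pL ->; exists p.2.
exists (x.1, xi); first by rewrite -memv_preim lfunE.
by rewrite lfunE /= /mixed_left /= -xxi; case: (x).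
Qed.

End Functoriality.

(* Main.v *)
(** The argument works over any field.  Since [eps] is alternating, every
    [u + alpha] in [L] has [alpha = eps(u, -) = 0] on [W], so [alpha] factors
    through [phi]; as moreover [W + 0] lies in [L], pulling back undoes pushing
    forward.  Maximality of [phi_* L] is then inherited from that of [L]: an
    isotropic [M] containing [phi_* L] has an isotropic pullback containing [L].
    If the projection of [phi_* L] to the dual of [V / W] were not onto, some
    [q <> 0] in [V / W] would be annihilated by it, so [q + 0] could be added to
    [phi_* L], hence would lie in it; a lift [X] of [q] would satisfy
    [X + 0 \in L], that is [X \in ker eps = W], forcing [q = 0]. *)
From HB Require Import structures.
Require Import Defs.
From mathcomp Require Import all_boot all_order all_algebra.
From mathcomp Require Import reals complex.

Set Implicit Arguments.
Unset Strict Implicit.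
Unset Printing Implicit Defensive.

Import GRing.Theory.
Local Open Scope ring_scope.

Section Factorization.
Variables (K : fieldType) (V V' U : vectType K).
Variables (f : 'Hom(V, V')) (g : 'Hom(V, U)).

(** [f^-1] inverts [f] only on its image, so [f^-1 (f v)] and [v] may differ, but only by an element
    of [lker f], which [g] kills. *)
Lemma lfun_factor : (lker f <= lker g)%VS -> ((g \o f^-1) \o f)%VF = g.
Proof.
move=> fg; apply/lfunP=> v; rewrite !comp_lfunE; apply/eqP.
rewrite -subr_eq0 -linearB -memv_ker; apply: (subvP fg).
by rewrite memv_ker linearB /= subr_eq0 limg_lfunVK // memv_img // memvf.
Qed.

End Factorization.

Lemma dim_dual (K : fieldType) (V : vectType K) : dim 'Hom(V, K^o) = dim V.
Proof. by rewrite /dim /= muln1. Qed.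

Section Annihilator.
Variables (K : fieldType) (V : vectType K).
Variable S : {vspace 'Hom(V, K^o)}.

(** The canonical map from V to its bidual, followed by restriction to [S]; its kernel is the
    annihilator of [S] in V. *)
Definition eval_on (v : V) : 'Hom(subvs_of S, K^o) :=
  linfun (fun xi : subvs_of S => vsval xi v).

Lemma eval_onE v xi : eval_on v xi = vsval xi v.
Proof.
have lin : linear (fun xi : subvs_of S => vsval xi v : K^o).
  by move=> a x y; rewrite linearP add_lfunE scale_lfunE.
pose ev : {linear subvs_of S -> K^o} :=
  HB.pack (fun xi : subvs_of S => vsval xi v : K^o)
    (GRing.isLinear.Build _ _ _ _ _ lin).
exact: (lfunE ev).
Qed.

Lemma eval_on_is_linear : linear eval_on.
Proof.
move=> a u v; apply/lfunP=> xi.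
by rewrite add_lfunE scale_lfunE !eval_onE linearP.
Qed.
HB.instance Definition _ :=
  GRing.isLinear.Build K V 'Hom(subvs_of S, K^o) *:%R eval_on eval_on_is_linear.

(** Rank-nullity for [eval_on]: the target, the dual of [S], has dimension less than [dim V], so the
    kernel is nonzero. *)
Lemma proper_dual_annihilator :
  S != fullv -> exists2 v, v != 0 & forall xi, xi \in S -> xi v = 0.
Proof.
move=> SnT.
have ltS : (\dim S < dim V)%N.
  by rewrite ltnNge; apply: contra SnT; rewrite eqEdim subvf dimvf dim_dual.
pose N := lker (linfun eval_on).
exists (vpick N).
  rewrite vpick0 -dimv_eq0 -lt0n.
  have := limg_ker_dim (linfun eval_on) fullv.
  rewrite capfv dimvf => dN.
  rewrite -(ltn_add2r (\dim (limg (linfun eval_on)))).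
  rewrite dN add0n; apply: leq_ltn_trans ltS.
  by apply: leq_trans (dimvS (subvf _)) _; rewrite dimvf dim_dual.
move=> xi xiS; have := memv_pick N.
rewrite memv_ker lfunE /= => /eqP/lfunP/(_ (Subvs xiS)).
by rewrite eval_onE zero_lfunE.
Qed.

End Annihilator.

Section Isotropy.
Variables (K : fieldType) (V V' : vectType K) (f : 'Hom(V, V')).

Lemma isotropic_pull (L' : {vspace V' * 'Hom(V', K^o)}) :
  isotropic L' -> isotropic (dirac_pull f L').
Proof.
move=> iso x y /dirac_pullP[xi x2 xL] /dirac_pullP[eta y2 yL].
by have := iso _ _ xL yL; rewrite /dirac_pairing x2 y2 !comp_lfunE.
Qed.

Lemma isotropic_push (L : {vspace V * 'Hom(V, K^o)}) :
  isotropic L -> isotropic (dirac_push f L).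
Proof.
move=> iso x y /dirac_pushP[X x1 xL] /dirac_pushP[Y y1 yL].
by have := iso _ _ xL yL; rewrite /dirac_pairing x1 y1 !comp_lfunE.
Qed.

Lemma dirac_pullS (L1 L2 : {vspace V' * 'Hom(V', K^o)}) :
  (L1 <= L2)%VS -> (dirac_pull f L1 <= dirac_pull f L2)%VS.
Proof.
move=> L12; apply/subvP=> x /dirac_pullP[xi x2 xL].
by apply/dirac_pullP; exists xi => //; apply: (subvP L12).
Qed.

Lemma linear_dirac_push (L : {vspace V * 'Hom(V, K^o)}) :
    limg f = fullv -> linear_dirac L -> dirac_pull f (dirac_push f L) = L ->
  linear_dirac (dirac_push f L).
Proof.
move=> f_onto [isoL maxL] LK; split=> [|M isoM LM].
  exact: isotropic_push.
have pullM : dirac_pull f M = L.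
  by apply: maxL; [exact: isotropic_pull | rewrite -{1}LK dirac_pullS].
apply/eqP; rewrite eqEsubv LM andbT; apply/subvP=> y yM.
(* Surjectivity lifts [y.1] to [X]; then [X] paired with the pullback of [y.2] lies in the pullback
   of [M], which is [L]. *)
have /memv_imgP[X _ yX] : y.1 \in limg f by rewrite f_onto memvf.
apply/dirac_pushP; exists X => //; rewrite -pullM.
by apply/dirac_pullP; exists y.2; rewrite //= -yX; case: (y) yM.
Qed.

(** Adjoining the line through [(v, 0)] keeps [L] isotropic, since the only new terms in the pairing
    are multiples of [x.2 v] for [x] in [L]; maximality then absorbs the line. *)
Lemma linear_dirac_mem (L : {vspace V * 'Hom(V, K^o)}) v :
    linear_dirac L -> (forall x, x \in L -> x.2 v = 0) ->
  (v, 0) \in L.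
Proof.
move=> [isoL maxL] Lv; pose M := (L + <[(v, 0%R : 'Hom(V, K^o))]>)%VS.
suff <- : M = L by rewrite -[X in X \in _]add0r memv_add ?mem0v ?memv_line.
apply: maxL; last exact: addvSl.
move=> _ y' /memv_addP[x xL [_ /vlineP[a ->] ->]].
case/memv_addP=> [y yL [_ /vlineP[b ->] {y'}->]].
rewrite -[RHS](isoL _ _ xL yL) /dirac_pairing /= !scaler0 !addr0.
by rewrite !linearD !linearZ /= !Lv // !scaler0 !addr0.
Qed.

End Isotropy.

Section ReductionByKernel.
Variables (K : fieldType) (V : vectType K) (E : {vspace V}).
Variable eps : 'Hom(subvs_of E, 'Hom(subvs_of E, K^o)).
Hypothesis eps_alt : alternating eps.
Local Notation L := (dirac_of eps).
Local Notation phi := (quotv_map (form_ker eps)).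

Lemma alternating_skew u v : eps u v = - eps v u.
Proof.
apply/eqP; rewrite -addr_eq0; apply/eqP.
have := eps_alt (u + v); rewrite !linearD /= !add_lfunE !eps_alt.
by rewrite add0r addr0 addrC.
Qed.

Lemma dirac_of_form_ker w : ((w, 0) \in L) = (w \in form_ker eps).
Proof.
apply/dirac_ofP/form_kerP => -[u /= -> eu]; exists u => // v.
  by rewrite -eu zero_lfunE.
by rewrite eu zero_lfunE.
Qed.

Lemma dirac_of_lker x : x \in L -> (lker phi <= lker x.2)%VS.
Proof.
case/dirac_ofP=> u _ xu; rewrite lker_quotv_map.
apply/subvP=> _ /form_kerP[w -> ew].
by rewrite memv_ker xu alternating_skew ew oppr0.
Qed.

Lemma dirac_pull_push_ker : dirac_pull phi (dirac_push phi L) = L.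
Proof.
apply/vspaceP=> x.
apply/dirac_pullP/idP => [[xi x2 /dirac_pushP[Y /= xY YL]]|xL].
  (* [Y] and [x.1] have the same image under [phi], so the correction term lies in W + 0, hence in
     [L]. *)
  have -> : x = (Y, (xi \o phi)%VF) + (x.1 - Y, 0).
    by case: x x2 {xY} => x1 x2 /= ->; congr (_, _);
      rewrite /= ?addr0 // addrC subrK.
  rewrite memvD // dirac_of_form_ker -(lker_quotv_map (form_ker eps)) memv_ker.
  by rewrite linearB /= xY subrr.
(* The witness is the functional induced by [x.2] on the quotient. *)
exists (x.2 \o phi^-1)%VF; first by rewrite lfun_factor ?dirac_of_lker.
apply/dirac_pushP; exists x.1; rewrite //= lfun_factor ?dirac_of_lker //.
by case: (x) xL.
Qed.

Lemma linear_poisson_push_ker :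
  linear_dirac L -> linear_poisson (dirac_push phi L).
Proof.
move=> diracL.
have diracP : linear_dirac (dirac_push phi L).
  by apply: linear_dirac_push; rewrite ?limg_quotv_map // dirac_pull_push_ker.
split=> //; apply/eqP/negPn/negP => /proper_dual_annihilator[q /eqP q0 qS].
have /dirac_pushP[X /= qX] : (q, 0) \in dirac_push phi L.
  apply: linear_dirac_mem => // x xP; apply: qS.
  by apply/memv_imgP; exists x; rewrite ?lfunE.
rewrite comp_lfun0l dirac_of_form_ker -(lker_quotv_map (form_ker eps)) memv_ker.
by rewrite -qX => /eqP.
Qed.

End ReductionByKernel.

Theorem corollary1p5 (R : realType) :
  (forall (V : vectType R) (L : {vspace V * 'Hom(V, R^o)}) (E : {vspace V})
      (eps : 'Hom(subvs_of E, 'Hom(subvs_of E, R^o))),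
    linear_dirac L -> alternating eps -> L = dirac_of eps ->
    let phi := quotv_map (form_ker eps) in
    L = dirac_pull phi (dirac_push phi L) /\ linear_poisson (dirac_push phi L))
  /\
  (forall (V : vectType R[i]) (L : {vspace V * 'Hom(V, R[i]^o)})
      (E : {vspace V})
      (eps : 'Hom(subvs_of E, 'Hom(subvs_of E, R[i]^o))),
    linear_dirac L -> alternating eps -> L = dirac_of eps ->
    let phi := quotv_map (form_ker eps) in
    L = dirac_pull phi (dirac_push phi L) /\ linear_poisson (dirac_push phi L)).
Proof.
split=> V L E eps diracL eps_alt L_def phi; rewrite {}/phi {}L_def in diracL *.
  by rewrite dirac_pull_push_ker //; split=> //; apply: linear_poisson_push_ker.
by rewrite dirac_pull_push_ker //; split=> //; apply: linear_poisson_push_ker.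
Qed.
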